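(* For all integers $n\geq0$, $b_{2,2}(n)\geq b_{2,3}(n)$.
   Context: A $2$-regular partition of $n$ is a partition of $n$ with no even parts (i.e. a partition into odd parts). The hook length of a box in the Young diagram of a partition (rows of lengths $\lambda_1\geq\lambda_2\geq\cdots$, left-justified) is the number of boxes directly to its right plus the number directly below it plus $1$. For $k\geq1$, $b_{2,k}(n)$ denotes the total number of boxes of hook length $k$, counted over all $2$-regular partitions of $n$ (with $b_{2,k}(0)=0$). *)

(* Defs.v *)
From mathcomp Require Import all_boot.

Set Implicit Arguments.
Unset Strict Implicit.
Unset Printing Implicit Defensive.

Definition is_partition (n : nat) (s : seq nat) : bool :=
  [&& sorted geq s, all (leq 1) s & sumn s == n].

(* All partitions of n with parts at most m; j is the multiplicity of the
   part m. See mem_partitions and uniq_partitions below. *)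
Fixpoint partitions_le (m n : nat) : seq (seq nat) :=
  if m is m'.+1 then
    flatten [seq [seq nseq j m ++ s | s <- partitions_le m' (n - j * m)]
            | j <- iota 0 (n %/ m).+1]
  else if n == 0 then [:: [::]] else [::].

Definition partitions (n : nat) : seq (seq nat) := partitions_le n n.

(* 0-indexed rows and columns: the box (i, j) lies in the diagram of s when
   i < size s and j < nth 0 s i. *)
Definition arm_length (s : seq nat) (i j : nat) : nat := nth 0 s i - j.+1.

Definition leg_length (s : seq nat) (i j : nat) : nat :=
  count (fun p => j < p) (drop i.+1 s).

Definition hook_length (s : seq nat) (i j : nat) : nat :=
  (arm_length s i j + leg_length s i j).+1.

Definition hook_count (k : nat) (s : seq nat) : nat :=
  \sum_(i < size s) \sum_(j < nth 0 s i) (hook_length s i j == k).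

Definition regular2 (s : seq nat) : bool := all odd s.

(* The number b_{2,k}(n). *)
Definition b2 (k n : nat) : nat :=
  \sum_(s <- partitions n | regular2 s) hook_count k s.

Lemma geq_trans : transitive geq.
Proof. by move=> y x z /= le_yx le_zy; apply: leq_trans le_zy le_yx. Qed.

Lemma sorted_nseq_cat m j s :
  sorted geq s -> all (geq m) s -> sorted geq (nseq j m ++ s).
Proof.
rewrite !(sorted_pairwise geq_trans) pairwise_cat => -> le_sm.
rewrite andbT; apply/andP; split.
  by apply/allrelP => x y /nseqP[-> _] /(allP le_sm).
by elim: j => //= j ->; rewrite andbT all_nseq /= leqnn orbT.
Qed.

Lemma sorted_geq_split m s : sorted geq s -> all (geq m.+1) s ->
  exists j t, [/\ s = nseq j m.+1 ++ t, sorted geq t & all (geq m) t].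
Proof.
elim: s => [|x s IHs] /=; first by exists 0, [::].
move=> pxs /andP[le_xm les].
move: le_xm; rewrite leq_eqVlt => /orP[/eqP-> | lt_xm].
  have [j [t [-> st lt]]] := IHs (path_sorted pxs) les.
  by exists j.+1, t.
exists 0, (x :: s); split=> //=; rewrite -ltnS lt_xm /=.
have /allP le_sx := order_path_min geq_trans pxs.
by apply/allP => y /le_sx /= le_yx; rewrite (leq_trans le_yx).
Qed.

Lemma mem_partitions_le m n s :
  (s \in partitions_le m n) = is_partition n s && all (geq m) s.
Proof.
elim: m n s => [|m IHm] n s.
  have -> : (s \in partitions_le 0 n) = (s == [::]) && (n == 0).
    by rewrite /=; case: (n == 0); rewrite ?inE ?andbT ?andbF.
  rewrite /is_partition; case: s => [|x s] /=; first by rewrite eq_sym andbT.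
  by case: x => [|x] /=; rewrite ?andbF.
apply/flattenP/idP => [[_ /mapP[j +->] /mapP[t + ->]]|].
  rewrite mem_iota add0n ltnS /= => le_j.
  rewrite IHm => /andP[/and3P[st pt /eqP sumt] ltm].
  have lt_t : all (geq m.+1) t.
    by apply: sub_all ltm => y /= /leqW.
  rewrite /is_partition sorted_nseq_cat // !all_cat pt lt_t !all_nseq /=.
  rewrite leqnn !orbT sumn_cat sumn_nseq sumt mulnC subnKC ?eqxx //.
  by rewrite -leq_divRL.
case/andP=> /and3P[ss ps /eqP sums] lsm.
have [j [t [eqs st ltm]]] := sorted_geq_split ss lsm.
have eqn : n = j * m.+1 + sumn t by rewrite -sums eqs sumn_cat sumn_nseq mulnC.
exists [seq nseq j m.+1 ++ s | s <- partitions_le m (n - j * m.+1)].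
  apply/mapP; exists j => //.
  by rewrite mem_iota add0n ltnS leq_divRL // eqn leq_addr.
apply/mapP; exists t => //; rewrite IHm ltm /is_partition st eqn addKn eqxx.
by move: ps; rewrite eqs all_cat => /andP[_ ->].
Qed.

Lemma mem_partitions n s : (s \in partitions n) = is_partition n s.
Proof.
rewrite mem_partitions_le andb_idr // => /and3P[_ _ /eqP <-].
elim: s => //= x s IHs; rewrite leq_addr /=.
by apply: sub_all IHs => y /= le_y; rewrite (leq_trans le_y) ?leq_addl.
Qed.

Lemma uniq_partitions_le m n : uniq (partitions_le m n).
Proof.
elim: m n => [|m IHm] n; first by rewrite /=; case: eqP.
have count_top j t : all (geq m) t -> count_mem m.+1 (nseq j m.+1 ++ t) = j.
  move=> /allP le_tm; rewrite count_cat count_nseq /= eqxx mul1n.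
  rewrite (count_memPn _) ?addn0 //.
  by apply/negP => /le_tm /=; rewrite ltnn.
apply: allpairs_uniq_dep => [|j _|]; rewrite ?iota_uniq //.
move=> u v /allpairsPdep[j [s [_ s_in ->]]] /allpairsPdep[k [t [_ t_in ->]]] /=.
move: s_in t_in; rewrite !mem_partitions_le => /andP[_ les] /andP[_ let_] e.
have eq_jk : j = k by rewrite -(count_top j s les) e count_top.
move: e; rewrite eq_jk => /eqP.
by rewrite eqseq_cat // eqxx => /eqP ->.
Qed.

Lemma uniq_partitions n : uniq (partitions n).
Proof. exact: uniq_partitions_le. Qed.

(* Main.v *)
Require Import Defs.
From mathcomp Require Import all_boot.
From mathcomp Require Import zify.

Set Implicit Arguments.
Unset Strict Implicit.
Unset Printing Implicit Defensive.

(** Let [m p] be the multiplicity of [p] in a partition into odd parts.  Reading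
    off arms and legs, the hooks of length 2 number
    [#{p | m p >= 2} + #{p >= 3 | m p >= 1}], and those of length 3 number
    [#{p | m p >= 3} + #{p >= 3 | m p >= 2} + #{p >= 3 | m p >= 1, m (p - 2) = 0}].
    Hence the theorem compares the pairs (partition, [p]) with [m p >= 3] to those
    with [p] and [p - 2] both parts, or with [p = 1] and [m 1 >= 2].  For odd
    [p >= 3], replacing two copies of [p] by one [p - 2] and [p + 2] ones is an
    injection from the former to the latter. *)

(** The branch at [p = 1] also avoids truncated subtraction, which makes [1 - 2] equal to 0. *)
Definition adjacent_part (s : seq nat) (p : nat) : bool :=
  if p == 1 then 1 < count_mem 1 s else (p \in s) && (p - 2 \in s).

Lemma sum_ord_update N (F G : nat -> nat) x d : x < N ->
  G x = F x + d -> (forall p, p != x -> G p = F p) ->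
  \sum_(p < N) G p = \sum_(p < N) F p + d.
Proof.
move=> ltxN Gx Gp; rewrite (bigD1 (Ordinal ltxN)) //= [in RHS](bigD1 (Ordinal ltxN)) //=.
by rewrite Gx addnAC; congr (_ + _ + _); apply: eq_bigr => i nix; apply: Gp.
Qed.

(** Arms and legs never look upward, so lower rows keep their hooks. The first row is indexed by arm
    length [a], so that only its last [k] boxes can matter. *)
Lemma hook_count_cons k x s : hook_count k (x :: s) =
  \sum_(a < x) ((a + count (fun q => x - a <= q) s).+1 == k) + hook_count k s.
Proof.
rewrite /hook_count /= big_ord_recl /=; congr (_ + _).
rewrite (reindex_inj rev_ord_inj) /=; apply: eq_bigr => a _.
rewrite /hook_length /arm_length /leg_length /= drop0.
have -> : x - (x - a.+1).+1 = a by have := ltn_ord a; lia.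
congr (nat_of_bool (_.+1 == _)); congr (_ + _); apply: eq_count => q /=.
by have := ltn_ord a; lia.
Qed.

Lemma count_geq_max x s : all (geq x) s -> count (leq x) s = count_mem x s.
Proof. by move=> /allP le_sx; apply: eq_in_count => q /le_sx /=; lia. Qed.

(** Parity: [x - 1] is even, hence not a part. *)
Lemma count_geq_max_pred x s : odd x -> all odd s -> all (geq x) s ->
  count (leq (x - 1)) s = count_mem x s.
Proof.
move=> odd_x /allP odd_s /allP le_sx; apply: eq_in_count => q qs /=.
by have := le_sx q qs; have := odd_s q qs; rewrite /=; lia.
Qed.

Lemma count_geq_max_pred2 x s : odd x -> all odd s -> all (geq x) s ->
  count (leq (x - 2)) s = count_mem x s + count_mem (x - 2) s.
Proof.
move=> odd_x odd_s le_sx; case: (ltnP 1 x) => [x_gt1|x_le1]; last first.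
  (* Here [x - 2] truncates to 0, which is not an odd part, and every part equals 1. *)
  have -> : x = 1 by move: odd_x x_le1; case: x {le_sx} => [|[|x]].
  rewrite (count_memPn (_ : 1 - 2 \notin s)) ?addn0; last first.
    by apply/negP => /(allP odd_s).
  apply: eq_in_count => q qs /=.
  by have := allP le_sx q qs; have := allP odd_s q qs; move=> /=; lia.
elim: s odd_s le_sx => //= q s IHs /andP[odd_q odd_s] /andP[le_qx le_sx].
by rewrite IHs //; lia.
Qed.

Section FirstRow.

Variables (x : nat) (s : seq nat).
Hypotheses (odd_x : odd x) (odd_s : all odd s) (le_sx : all (geq x) s).

(** The pair (arm, leg) is (0, 1) or (1, 0), the latter only if the row has two boxes. *)
Lemma first_row_hook2 :
  \sum_(a < x) ((a + count (fun q => x - a <= q) s).+1 == 2) =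
  (count_mem x s == 1) + ((1 < x) && (count_mem x s == 0)).
Proof.
case: (ltnP 1 x) => [x_gt1|x_le1].
  have [y eq_x] : exists y, x = y.+2 by exists x.-2; lia.
  move: (count_geq_max le_sx) (count_geq_max_pred odd_x odd_s le_sx).
  rewrite eq_x 2!big_ord_recl big1 => [|i _]; last by rewrite /= /bump; lia.
  by rewrite /= /bump !addn0 subn0 => -> ->; lia.
have eq_x : x = 1 by lia.
move: (count_geq_max le_sx); rewrite eq_x big_ord_recl big_ord0 /= subn0 => ->.
by lia.
Qed.

Lemma first_row_hook3 :
  \sum_(a < x) ((a + count (fun q => x - a <= q) s).+1 == 3) =
  (count_mem x s == 2) + ((1 < x) && (count_mem x s == 1))
  + ((1 < x) && (count_mem x s + count_mem (x - 2) s == 0)).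
Proof.
case: (ltnP 1 x) => [x_gt1|x_le1].
  (* An odd [x > 1] is at least 3, so boxes with arms 0, 1 and 2 all exist. *)
  have [y eq_x] : exists y, x = y.+3 by exists (x - 3); lia.
  move: (count_geq_max le_sx) (count_geq_max_pred odd_x odd_s le_sx).
  move: (count_geq_max_pred2 odd_x odd_s le_sx).
  rewrite eq_x 3!big_ord_recl big1 => [|i _]; last by rewrite /= /bump; lia.
  by rewrite /= /bump !addn0 subn0 => -> -> ->; lia.
have eq_x : x = 1 by lia.
move: (count_geq_max le_sx); rewrite eq_x big_ord_recl big_ord0 /= subn0 => ->.
by lia.
Qed.

Lemma sum_repeated_cons N : x < N ->
  \sum_(p < N) (2 < count_mem (p : nat) (x :: s)) =
  \sum_(p < N) (2 < count_mem (p : nat) s) + (count_mem x s == 2).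
Proof.
move=> ltxN; apply: (@sum_ord_update _ (fun p => 2 < count_mem p s)
  (fun p => 2 < count_mem p (x :: s)) x) => // [|p npx] /=.
  by rewrite eqxx; lia.
by rewrite eq_sym (negPf npx).
Qed.

Lemma sum_adjacent_cons N : x < N ->
  \sum_(p < N) adjacent_part (x :: s) p =
  \sum_(p < N) adjacent_part s p +
  (if x == 1 then count_mem 1 s == 1
   else (count_mem x s == 0) && (0 < count_mem (x - 2) s)).
Proof.
move=> ltxN; apply: (@sum_ord_update _ (adjacent_part s)
  (adjacent_part (x :: s)) x) => // [|p npx] /=; rewrite /adjacent_part.
  case: (x =P 1) => [->|nx1] /=; first by rewrite add1n ltnS; lia.
  have -> : (x - 2 \in x :: s) = (x - 2 \in s).
    by rewrite inE (_ : (x - 2 == x) = false) //; lia.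
  rewrite mem_head -!has_pred1 !has_count.
  by case: (count_mem x s) => [|c] /=; rewrite ?addn0.
case: (p =P 1) => [p1|np1] /=; first by rewrite -p1 eq_sym (negPf npx).
(* Besides [p = x], the new part could only affect [p = x + 2], which exceeds the largest part. *)
rewrite !inE (negPf npx) /=; case: (p =P x + 2) => [->|npx2].
  have /negPf-> // : x + 2 \notin s.
  by apply/negP => /(allP le_sx) /=; lia.
case ps: (p \in s) => //=.
have odd_p := allP odd_s p ps.
by rewrite (_ : (p - 2 == x) = false) //; lia.
Qed.

End FirstRow.

(** Induction on the rows: prepending a largest part changes both sides equally. Terms are placed so
    that no subtraction occurs. *)
Lemma hook_count_balance N s : sorted geq s -> all odd s -> all (gtn N) s ->
  hook_count 3 s + \sum_(p < N) adjacent_part s p =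
  hook_count 2 s + \sum_(p < N) (2 < count_mem (p : nat) s).
Proof.
elim: s => [|x s IHs].
  rewrite /hook_count !big_ord0 !big1 // => p _.
  by rewrite /adjacent_part; case: eqP.
move=> sort_xs /andP[odd_x odd_s] /andP[ltxN ltsN].
have le_sx := order_path_min geq_trans sort_xs.
have := IHs (path_sorted sort_xs) odd_s ltsN.
rewrite !hook_count_cons first_row_hook2 // first_row_hook3 //.
rewrite sum_repeated_cons // sum_adjacent_cons //.
by case: (x =P 1) => [->|nx1]; lia.
Qed.

(** The size is kept since [2p = (p - 2) + (p + 2)]; sorting restores the canonical form of a
    partition. *)
Definition split_parts (p : nat) (s : seq nat) : seq nat :=
  sort geq (p - 2 :: nseq (p + 2) 1 ++ rem p (rem p s)).

Lemma perm_rem2 (p : nat) s : 2 < count_mem p s ->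
  perm_eq s [:: p, p & rem p (rem p s)] /\ p \in rem p (rem p s).
Proof.
move=> cnt; have ps : p \in s by rewrite -has_pred1 has_count; apply: ltnW (ltnW cnt).
have cnt1 : 1 < count_mem p (rem p s) by rewrite count_rem ps /= eqxx ltn_subRL.
have pr : p \in rem p s by rewrite -has_pred1 has_count ltnW.
split; first by rewrite (permPl (perm_to_rem ps)) perm_cons perm_to_rem.
by rewrite -has_pred1 has_count count_rem pr /= eqxx subn_gt0.
Qed.

Lemma geq_total : total geq.
Proof. by move=> x y; apply: leq_total. Qed.

Lemma geq_anti : antisymmetric geq.
Proof. by move=> x y /=; lia. Qed.

(** The third copy of [p] survives beside the new part [p - 2], which is odd and positive as
    [p >= 3]. *)
Lemma split_partsP n p s : odd p -> p != 1 -> is_partition n s -> all odd s ->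
  2 < count_mem p s ->
  [/\ is_partition n (split_parts p s), all odd (split_parts p s)
    & adjacent_part (split_parts p s) p].
Proof.
move=> odd_p np1 /and3P[_ pos_s /eqP sum_s] odd_s /perm_rem2[].
set t := rem p (rem p s) => perm_s pt.
have sum_t : n = p + (p + sumn t) by rewrite -sum_s (perm_sumn perm_s).
move: pos_s odd_s; rewrite !(perm_all _ perm_s) /=.
case/and3P=> p_gt0 _ pos_t /and3P[_ _ odd_t].
rewrite /split_parts -/t /is_partition (sort_sorted geq_total) !all_sort /=.
rewrite !all_cat !all_nseq /= pos_t odd_t !orbT !andbT.
rewrite (perm_sumn (permEl (perm_sort _ _))) /= sumn_cat sumn_nseq.
rewrite /adjacent_part (negPf np1) !mem_sort !inE mem_cat pt eqxx !orbT.
by split=> //; lia.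
Qed.

(** The parts removed and added depend only on [p], so they cancel as multisets, and a sorted list
    is determined by its multiset. *)
Lemma split_parts_inj p s t : sorted geq s -> sorted geq t ->
  2 < count_mem p s -> 2 < count_mem p t ->
  split_parts p s = split_parts p t -> s = t.
Proof.
move=> ss st /perm_rem2[perm_s _] /perm_rem2[perm_t _] eq_st.
apply: (sorted_eq geq_trans geq_anti) => //.
rewrite (permPl perm_s) perm_sym (permPl perm_t) !perm_cons perm_sym.
by move/(perm_sortP geq_total geq_trans geq_anti): eq_st; rewrite perm_cons perm_cat2l.
Qed.

Lemma sum_repeated_le_adjacent n p :
  \sum_(s <- partitions n | regular2 s) (2 < count_mem p s) <=
  \sum_(s <- partitions n | regular2 s) adjacent_part s p.
Proof.
case: (eqVneq p 1) => [->|np1].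
  by apply: leq_sum => s _; rewrite /adjacent_part eqxx; lia.
case odd_p : (odd p); last first.
  rewrite big1 // => s odd_s; rewrite (count_memPn _) //.
  by apply/negP => /(allP odd_s); rewrite odd_p.
rewrite -!big_mkcondr /= !sum1_count -!size_filter.
set P := fun s => _; set Q := fun s => _.
(* Both sums are now sizes of duplicate-free lists; the image of the first under the injection lies
   in the second. *)
rewrite -(size_map (split_parts p)); apply: uniq_leq_size.
  rewrite map_inj_in_uniq ?filter_uniq ?uniq_partitions // => s t.
  rewrite !mem_filter !mem_partitions => /andP[/andP[_ cs] /and3P[ss _ _]].
  by case/andP=> /andP[_ ct] /and3P[st _ _]; apply: split_parts_inj.
move=> _ /mapP[s + ->]; rewrite !mem_filter !mem_partitions.
case/andP=> /andP[odd_s cs] part_s.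
have [part_t odd_t adj_t] := split_partsP odd_p np1 part_s odd_s cs.
by rewrite part_t /Q /regular2 odd_t adj_t.
Qed.

Theorem theorem1p5 (n : nat) : b2 2 n >= b2 3 n.
Proof.
(* No part exceeds [n], so [p < n.+1] covers every part; exchanging the sums then allows comparison
   for each [p] separately. *)
pose A := \sum_(s <- partitions n | regular2 s)
  \sum_(p < n.+1) adjacent_part s p.
pose B := \sum_(s <- partitions n | regular2 s)
  \sum_(p < n.+1) (2 < count_mem (p : nat) s).
have leBA : B <= A.
  rewrite /A /B !(exchange_big _ _ (index_enum _)) /=.
  by apply: leq_sum => p _; apply: sum_repeated_le_adjacent.
suff: b2 3 n + A = b2 2 n + B by lia.
rewrite /b2 /A /B -!big_split /= big_seq_cond [RHS]big_seq_cond.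
apply: eq_bigr => s /andP[]; rewrite mem_partitions_le.
case/andP=> /and3P[sort_s _ _] le_sn odd_s.
exact: hook_count_balance.
Qed.
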